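(* There are constants $c,d$ such that for every $n\ge1$ there is a $\mathbf{PC}^=$-proof $\pi_n$ of $\forall\boldsymbol{\lambda}\mathbf I\to(\forall x.\,px=p(qx))\to E_n$ with $\mathrm{cc}(\pi_n)\le c\cdot n+d$.
   Context: Language: a left-associative binary function symbol $\circ$ (application, written as juxtaposition), constants $S,B,C,I,p,q$, equality. $\boldsymbol{\lambda}\mathbf I$ is the set of equations $Sxyz=xz(yz)$, $Bxyz=x(yz)$, $Cxyz=xzy$, $Ix=x$; $\forall\boldsymbol{\lambda}\mathbf I$ is the set of their universal closures, and $\{A_1,\dots,A_m\}\to F$ means $A_1\to\dots\to A_m\to F$. $T:=SB(CBI)$, $T_1:=T$, $T_{n+1}:=T_nT$, $E_n:=\ pq=p(T_nqq)$. $\mathbf{PC}^=$ is the Hilbert-style predicate calculus with equality: initial formulas are propositional tautologies, $\forall xA(x)\to A(t)$ ($\forall^-$), $A(t)\to\exists xA(x)$ ($\exists^+$), and the equality axioms $t=t$, $s=t\to t=s$, $s=t\to t=u\to s=u$, $\vec s=\vec t\to f\vec s=f\vec t$, $\vec s=\vec t\to P\vec s\to P\vec t$; rules are modus ponens, from $A\to B(a)$ infer $A\to\forall xB(x)$, and from $A(a)\to B$ infer $\exists xA(x)\to B$ (eigenvariable $a$ not in the conclusion). The critical count $\mathrm{cc}(\pi)$ is the number of instances of $\forall^-$ and $\exists^+$ in $\pi$. *)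

(* Defs.v *)
From Stdlib Require Import List Arith Bool.
Import ListNotations.

Inductive constant : Set := cS | cB | cC | cI | cp | cq.

(* Locally nameless syntax: [Free a] is a free variable (the possible
   eigenvariables), [Bound i] a de Bruijn index pointing to the i-th enclosing
   quantifier, so formulas are identified up to renaming of bound variables. *)
Inductive term : Set :=
| Free (a : nat)
| Bound (i : nat)
| Const (c : constant)
| App (s t : term).

Coercion Const : constant >-> term.

Inductive formula : Set :=
| Eq (s t : term)
| Neg (A : formula)
| And (A B : formula)
| Or (A B : formula)
| Imp (A B : formula)
| All (A : formula)
| Ex (A : formula).

Declare Scope fo_scope.
Delimit Scope fo_scope with fo.
Bind Scope fo_scope with term formula.
Notation "s ∘ t" := (App s t) (at level 40, left associativity) : fo_scope.
Notation "s ≐ t" := (Eq s t) (at level 70, no associativity) : fo_scope.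
Notation "A ⊃ B" := (Imp A B) (at level 85, right associativity) : fo_scope.
Open Scope fo_scope.

(* [lc_* k]: every de Bruijn index is bound, up to k outer quantifiers.  The
   terms and formulas of the object language are those with k = 0. *)
Fixpoint lc_term (k : nat) (t : term) : Prop :=
  match t with
  | Bound i => i < k
  | App s t => lc_term k s /\ lc_term k t
  | Free _ | Const _ => True
  end.

Fixpoint lc_formula (k : nat) (A : formula) : Prop :=
  match A with
  | Eq s t => lc_term k s /\ lc_term k t
  | Neg A => lc_formula k A
  | And A B | Or A B | Imp A B => lc_formula k A /\ lc_formula k B
  | All A | Ex A => lc_formula (S k) A
  end.

Fixpoint occurs_term (a : nat) (t : term) : Prop :=
  match t with
  | Free b => a = b
  | App s t => occurs_term a s \/ occurs_term a t
  | Bound _ | Const _ => False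
  end.

Fixpoint occurs (a : nat) (A : formula) : Prop :=
  match A with
  | Eq s t => occurs_term a s \/ occurs_term a t
  | Neg A => occurs a A
  | And A B | Or A B | Imp A B => occurs a A \/ occurs a B
  | All A | Ex A => occurs a A
  end.

Fixpoint subst_term (k : nat) (u t : term) : term :=
  match t with
  | Bound i => if Nat.eqb i k then u else t
  | App s t => subst_term k u s ∘ subst_term k u t
  | Free _ | Const _ => t
  end.

Fixpoint subst (k : nat) (u : term) (A : formula) : formula :=
  match A with
  | Eq s t => subst_term k u s ≐ subst_term k u t
  | Neg A => Neg (subst k u A)
  | And A B => And (subst k u A) (subst k u B)
  | Or A B => Or (subst k u A) (subst k u B)
  | Imp A B => subst k u A ⊃ subst k u B
  | All A => All (subst (S k) u A)
  | Ex A => Ex (subst (S k) u A)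
  end.

(* A(u), where A(x) is the body of the quantified formulas [All A], [Ex A].
   Capture-free only when [u] is locally closed ([lc_term 0 u]). *)
Definition inst (A : formula) (u : term) : formula := subst 0 u A.

(* The prime formulas of propositional logic are the equations and the
   quantified formulas. *)
Fixpoint eval_prop (v : formula -> bool) (A : formula) : bool :=
  match A with
  | Eq _ _ | All _ | Ex _ => v A
  | Neg A => negb (eval_prop v A)
  | And A B => eval_prop v A && eval_prop v B
  | Or A B => eval_prop v A || eval_prop v B
  | Imp A B => implb (eval_prop v A) (eval_prop v B)
  end.

Definition tautology (A : formula) : Prop :=
  forall v : formula -> bool, eval_prop v A = true.

(* The congruence axioms are those of the only proper function symbol and the
   only predicate symbol; for constants they are instances of reflexivity. *)
Inductive equality_axiom : formula -> Prop :=
| eq_refl_ax t : equality_axiom (t ≐ t)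
| eq_sym_ax s t : equality_axiom (s ≐ t ⊃ t ≐ s)
| eq_trans_ax s t u : equality_axiom (s ≐ t ⊃ t ≐ u ⊃ s ≐ u)
| eq_app_ax s1 s2 t1 t2 :
    equality_axiom (s1 ≐ t1 ⊃ s2 ≐ t2 ⊃ s1 ∘ s2 ≐ t1 ∘ t2)
| eq_eq_ax s1 s2 t1 t2 :
    equality_axiom (s1 ≐ t1 ⊃ s2 ≐ t2 ⊃ s1 ≐ s2 ⊃ t1 ≐ t2).

Inductive rule : Set :=
| r_taut | r_all_elim | r_ex_intro | r_equality | r_mp | r_all | r_ex.

Inductive justified (prev : list formula) : rule -> formula -> Prop :=
| j_taut A : tautology A -> justified prev r_taut A
| j_all_elim A t : lc_term 0 t -> justified prev r_all_elim (All A ⊃ inst A t)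
| j_ex_intro A t : lc_term 0 t -> justified prev r_ex_intro (inst A t ⊃ Ex A)
| j_equality A : equality_axiom A -> justified prev r_equality A
| j_mp A B : In A prev -> In (A ⊃ B) prev -> justified prev r_mp B
| j_all A B a :
    In (A ⊃ inst B (Free a)) prev -> ~ occurs a (A ⊃ All B) ->
    justified prev r_all (A ⊃ All B)
| j_ex A B a :
    In (inst A (Free a) ⊃ B) prev -> ~ occurs a (Ex A ⊃ B) ->
    justified prev r_ex (Ex A ⊃ B).

Definition proof : Set := list (rule * formula).

Definition is_proof (pi : proof) : Prop :=
  forall i r A, nth_error pi i = Some (r, A) ->
    lc_formula 0 A /\ justified (map snd (firstn i pi)) r A.

Definition proves (pi : proof) (A : formula) : Prop :=
  is_proof pi /\ exists pi' r, pi = pi' ++ [(r, A)].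

Definition critical (r : rule) : bool :=
  match r with r_all_elim | r_ex_intro => true | _ => false end.

Definition cc (pi : proof) : nat :=
  length (filter (fun l => critical (fst l)) pi).

(* {A_1, ..., A_m} -> F *)
Definition imp_list (G : list formula) (F : formula) : formula :=
  fold_right Imp F G.

Definition all_lambdaI : list formula :=
  [ (* x, y, z = Bound 2, 1, 0 *)
    All (All (All (cS ∘ Bound 2 ∘ Bound 1 ∘ Bound 0
                   ≐ Bound 2 ∘ Bound 0 ∘ (Bound 1 ∘ Bound 0))));
    All (All (All (cB ∘ Bound 2 ∘ Bound 1 ∘ Bound 0
                   ≐ Bound 2 ∘ (Bound 1 ∘ Bound 0))));
    All (All (All (cC ∘ Bound 2 ∘ Bound 1 ∘ Bound 0
                   ≐ Bound 2 ∘ Bound 0 ∘ Bound 1)));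
    All (cI ∘ Bound 0 ≐ Bound 0) ].

Definition T : term := cS ∘ cB ∘ (cC ∘ cB ∘ cI).

(* Meaningful for n >= 1; the value at 0 is a dummy. *)
Fixpoint Tn (n : nat) : term :=
  match n with
  | 0 | 1 => T
  | S m => Tn m ∘ T
  end.

Definition E (n : nat) : formula := cp ∘ cq ≐ cp ∘ (Tn n ∘ cq ∘ cq).

Definition p_invariant : formula := All (cp ∘ Bound 0 ≐ cp ∘ (cq ∘ Bound 0)).

(* Main.v *)
(** The combinator [T] is the Church numeral 2, so [Tn n] is a tower of [n]
    twos and unfolding [Tn n ∘ cq ∘ cq] would be far too expensive.  Instead one
    uses the hierarchy of predicates
      [P 0 y := ∀x. p x = p (y x)],   [P (k+1) y := ∀w. P k w → P k (y w)].
    Since [T y w = y (y w)], every [P (k+1) T] holds, at a constant cost once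
    [P k] is known to respect equality; that fact is in turn proved level by
    level, each level from the previous one.  From [P n T] and [P (n-1) T] one
    gets [P (n-1) (T T)], then [P (n-2) (T T T)], and so on down to
    [P 1 (Tn n)], which applied to [P 0 q] gives [P 0 (Tn n q)]. *)

From Stdlib Require Import List Arith Bool Lia.
Require Import Defs.
Import ListNotations.

(** * Cost-annotated derivability *)

Definition thm (m : nat) (A : formula) : Prop :=
  exists pi, proves pi A /\ cc pi <= m.

Lemma justified_incl prev prev' r A :
  incl prev prev' -> justified prev r A -> justified prev' r A.
Proof.
  intros Hi H; destruct H.
  1-4: now constructor.
  - apply j_mp with A; now apply Hi.
  - apply j_all with a; [now apply Hi|assumption].
  - apply j_ex with a; [now apply Hi|assumption].
Qed.

Lemma is_proof_app pi1 pi2 :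
  is_proof pi1 -> is_proof pi2 -> is_proof (pi1 ++ pi2).
Proof.
  intros H1 H2 i r A Hi.
  destruct (Nat.lt_ge_cases i (length pi1)) as [Hl|Hl].
  - rewrite nth_error_app1 in Hi by assumption.
    destruct (H1 _ _ _ Hi) as [Hlc Hj]; split; [assumption|].
    revert Hj; apply justified_incl; rewrite firstn_app, map_app.
    apply incl_appl, incl_refl.
  - rewrite nth_error_app2 in Hi by assumption.
    destruct (H2 _ _ _ Hi) as [Hlc Hj]; split; [assumption|].
    revert Hj; apply justified_incl; rewrite firstn_app, map_app.
    apply incl_appr, incl_refl.
Qed.

Lemma proves_snoc pi r A :
  is_proof pi -> lc_formula 0 A -> justified (map snd pi) r A ->
  proves (pi ++ [(r, A)]) A.
Proof.
  intros Hp Hlc Hj; split; [|eauto].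
  intros i r' A' Hi.
  destruct (Nat.lt_ge_cases i (length pi)) as [Hl|Hl].
  - rewrite nth_error_app1 in Hi by assumption.
    rewrite firstn_app, (proj2 (Nat.sub_0_le i (length pi))), app_nil_r by lia.
    exact (Hp _ _ _ Hi).
  - rewrite nth_error_app2 in Hi by assumption.
    destruct (i - length pi) as [|j] eqn:Hij; simpl in Hi.
    + injection Hi as <- <-; split; [assumption|].
      replace i with (length pi) by lia.
      rewrite firstn_app, firstn_all, Nat.sub_diag, app_nil_r; assumption.
    + destruct j; discriminate.
Qed.

Lemma proves_In pi A : proves pi A -> In A (map snd pi).
Proof.
  intros [_ (pi' & r & ->)].
  rewrite map_app; apply in_or_app; right; now left.
Qed.

Lemma proves_lc pi A : proves pi A -> lc_formula 0 A.
Proof.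
  intros [Hp (pi' & r & ->)].
  refine (proj1 (Hp (length pi') r A _)).
  now rewrite nth_error_app2, Nat.sub_diag.
Qed.

Lemma cc_app pi1 pi2 : cc (pi1 ++ pi2) = cc pi1 + cc pi2.
Proof. unfold cc; now rewrite filter_app, length_app. Qed.

Lemma thm_lc m A : thm m A -> lc_formula 0 A.
Proof. intros (pi & Hp & _); exact (proves_lc _ _ Hp). Qed.

Lemma thm_axiom r A :
  lc_formula 0 A -> justified [] r A -> thm (if critical r then 1 else 0) A.
Proof.
  intros Hlc Hj; exists ([] ++ [(r, A)]); split.
  - apply proves_snoc; [|assumption..]. now intros [|i] ? ?.
  - unfold cc; simpl; now destruct (critical r).
Qed.

Lemma thm_taut A : lc_formula 0 A -> tautology A -> thm 0 A.
Proof.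
  intros Hlc Ht; apply (thm_axiom r_taut); [assumption|now constructor].
Qed.

Lemma thm_equality A : lc_formula 0 A -> equality_axiom A -> thm 0 A.
Proof.
  intros Hlc He; apply (thm_axiom r_equality); [assumption|now constructor].
Qed.

(** Concatenation pays for a premise every time it is used; sharing a premise has to be arranged
    through the hypotheses, by [entails_cut]. *)
Lemma thm_mp m1 m2 A B : thm m1 (A ⊃ B) -> thm m2 A -> thm (m1 + m2) B.
Proof.
  intros (pi1 & H1 & Hc1) (pi2 & H2 & Hc2).
  exists ((pi1 ++ pi2) ++ [(r_mp, B)]); split.
  - apply proves_snoc.
    + apply is_proof_app; [apply H1|apply H2].
    + exact (proj2 (proves_lc _ _ H1)).
    + apply j_mp with A; rewrite map_app; apply in_or_app;
        [right|left]; now apply proves_In.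
  - rewrite !cc_app; change (cc [(r_mp, B)]) with 0; lia.
Qed.

Lemma thm_generalize m A B a :
  lc_formula 0 (A ⊃ All B) -> ~ occurs a (A ⊃ All B) ->
  thm m (A ⊃ inst B (Free a)) -> thm m (A ⊃ All B).
Proof.
  intros Hlc Ha (pi & Hp & Hc).
  exists (pi ++ [(r_all, A ⊃ All B)]); split.
  - apply proves_snoc; [apply Hp|assumption|].
    apply j_all with a; [now apply proves_In|assumption].
  - rewrite cc_app; change (cc [(r_all, A ⊃ All B)]) with 0; lia.
Qed.

(** * Derivability from hypotheses *)

Definition top : formula := cI ≐ cI ⊃ cI ≐ cI.

Definition conj (G : list formula) : formula := fold_right And top G.

(** With the hypotheses gathered in one antecedent, the structural rules are tautologies and cost
    nothing, and the rule for the universal quantifier applies directly. Of the rules below, only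
    [entails_all_elim] adds a critical formula. *)
Definition entails (G : list formula) (m : nat) (A : formula) : Prop :=
  thm m (conj G ⊃ A).

Notation "G ⊢[ m ] A" := (entails G m A) (at level 90, m at level 200).

Lemma lc_conj G : lc_formula 0 (conj G) <-> Forall (lc_formula 0) G.
Proof.
  induction G as [|A G IH]; simpl.
  - split; [constructor|tauto].
  - rewrite IH, Forall_cons_iff; tauto.
Qed.

Lemma occurs_conj a G : occurs a (conj G) <-> Exists (occurs a) G.
Proof.
  induction G as [|A G IH]; simpl.
  - rewrite Exists_nil; tauto.
  - rewrite IH, Exists_cons; tauto.
Qed.

Lemma eval_conj v G : eval_prop v (conj G) = forallb (eval_prop v) G.
Proof.
  induction G as [|A G IH]; simpl.
  - now destruct (v _).
  - now rewrite IH.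
Qed.

Ltac taut :=
  let v := fresh "v" in intro v; simpl;
  repeat match goal with
         | |- context [eval_prop v ?X] => destruct (eval_prop v X)
         | |- context [v ?X] => destruct (v X)
         end; reflexivity.

Section Rules.

Variable G : list formula.

Lemma entails_lc_ctx m A : (G ⊢[m] A) -> Forall (lc_formula 0) G.
Proof. intro H; apply thm_lc in H; apply lc_conj, H. Qed.

Lemma entails_lc m A : (G ⊢[m] A) -> lc_formula 0 A.
Proof. intro H; apply thm_lc in H; apply H. Qed.

Lemma entails_le m m' A : m <= m' -> (G ⊢[m] A) -> (G ⊢[m'] A).
Proof. intros Hm (pi & Hp & Hc); exists pi; split; [assumption|lia]. Qed.

Lemma entails_thm m A : Forall (lc_formula 0) G -> thm m A -> (G ⊢[m] A).
Proof.
  intros HG HA; pose proof (thm_lc _ _ HA) as HlA; apply lc_conj in HG.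
  refine (thm_mp 0 m _ _ (thm_taut _ _ _) HA); [simpl; tauto|taut].
Qed.

Lemma entails_mp m1 m2 A B :
  (G ⊢[m1] A ⊃ B) -> (G ⊢[m2] A) -> (G ⊢[m1 + m2] B).
Proof.
  intros H1 H2; pose proof (thm_lc _ _ H1) as Hl; simpl in Hl.
  refine (thm_mp _ _ _ _ (thm_mp 0 _ _ _ (thm_taut _ _ _) H1) H2);
    [simpl; tauto|taut].
Qed.

Lemma entails_weaken G' m A :
  incl G' G -> Forall (lc_formula 0) G -> (G' ⊢[m] A) -> (G ⊢[m] A).
Proof.
  intros Hi HG HA; pose proof (thm_lc _ _ HA) as Hl; simpl in Hl.
  apply lc_conj in HG.
  refine (thm_mp 0 m _ _ (thm_taut _ _ _) HA); [simpl; tauto|].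
  intro v; simpl; rewrite !eval_conj.
  destruct (forallb (eval_prop v) G) eqn:HfG.
  - replace (forallb (eval_prop v) G') with true;
      [now destruct (eval_prop v A)|].
    symmetry; apply forallb_forall; intros B HB.
    now apply (proj1 (forallb_forall _ _) HfG), Hi.
  - simpl; now rewrite implb_true_r.
Qed.

Lemma entails_intro m A B : (A :: G ⊢[m] B) -> (G ⊢[m] A ⊃ B).
Proof.
  intro H; pose proof (thm_lc _ _ H) as Hl; simpl in Hl.
  refine (thm_mp 0 m _ _ (thm_taut _ _ _) H); [simpl; tauto|taut].
Qed.

Lemma entails_all_elim m A t :
  lc_term 0 t -> lc_formula 0 (inst A t) ->
  (G ⊢[m] All A) -> (G ⊢[S m] inst A t).
Proof.
  intros Ht Hlc H.
  refine (entails_mp 1 m _ _ (entails_thm _ _ (entails_lc_ctx _ _ H) _) H).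
  apply (thm_axiom r_all_elim); [|now constructor].
  split; [exact (entails_lc _ _ H)|assumption].
Qed.

Lemma entails_all_intro m A a :
  lc_formula 1 A -> ~ occurs a A -> ~ Exists (occurs a) G ->
  (G ⊢[m] inst A (Free a)) -> (G ⊢[m] All A).
Proof.
  intros HA Ha HGa H; apply thm_generalize with a; [|simpl|assumption].
  - split; [apply (thm_lc _ _ H)|assumption].
  - rewrite occurs_conj; tauto.
Qed.

Hypothesis HG : Forall (lc_formula 0) G.

Lemma entails_hyp A : In A G -> (G ⊢[0] A).
Proof.
  intro HA; apply entails_weaken with [A]; [now intros ? [<-|[]]|assumption|].
  rewrite Forall_forall in HG.
  apply thm_taut; [specialize (HG _ HA); simpl; tauto|taut].
Qed.

(** [A] is paid for once and is then a hypothesis, usable any number of times at cost 0. The context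
    [G'] lets [A] be proved from just the few formulas it depends on. *)
Lemma entails_cut G' m1 m2 A B :
  incl G' G -> (G' ⊢[m1] A) -> (A :: G ⊢[m2] B) -> (G ⊢[m1 + m2] B).
Proof.
  intros Hi HA HB; rewrite Nat.add_comm; apply entails_mp with A.
  - now apply entails_intro.
  - now apply entails_weaken with G'.
Qed.

Lemma entails_refl t : lc_term 0 t -> (G ⊢[0] t ≐ t).
Proof.
  intro Ht; apply entails_thm; [assumption|].
  apply thm_equality; [now split|constructor].
Qed.

Lemma entails_sym m s t : (G ⊢[m] s ≐ t) -> (G ⊢[m] t ≐ s).
Proof.
  intro H; pose proof (entails_lc _ _ H) as Hl.
  refine (entails_mp 0 m _ _ (entails_thm _ _ HG _) H).
  apply thm_equality; [simpl in *; tauto|constructor].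
Qed.

Lemma entails_trans m1 m2 s t u :
  (G ⊢[m1] s ≐ t) -> (G ⊢[m2] t ≐ u) -> (G ⊢[m1 + m2] s ≐ u).
Proof.
  intros H1 H2; pose proof (entails_lc _ _ H1); pose proof (entails_lc _ _ H2).
  refine (entails_mp _ _ _ _ (entails_mp 0 _ _ _ (entails_thm _ _ HG _) H1) H2).
  apply thm_equality; [simpl in *; tauto|constructor].
Qed.

Lemma entails_app m1 m2 s1 s2 t1 t2 :
  (G ⊢[m1] s1 ≐ t1) -> (G ⊢[m2] s2 ≐ t2) -> (G ⊢[m1 + m2] s1 ∘ s2 ≐ t1 ∘ t2).
Proof.
  intros H1 H2; pose proof (entails_lc _ _ H1); pose proof (entails_lc _ _ H2).
  refine (entails_mp _ _ _ _ (entails_mp 0 _ _ _ (entails_thm _ _ HG _) H1) H2).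
  apply thm_equality; [simpl in *; tauto|constructor].
Qed.

Lemma entails_app_l m s t u :
  lc_term 0 u -> (G ⊢[m] s ≐ t) -> (G ⊢[m] s ∘ u ≐ t ∘ u).
Proof.
  intros Hu H; rewrite <- (Nat.add_0_r m).
  apply entails_app; [assumption|now apply entails_refl].
Qed.

Lemma entails_app_r m s t u :
  lc_term 0 u -> (G ⊢[m] s ≐ t) -> (G ⊢[m] u ∘ s ≐ u ∘ t).
Proof.
  intros Hu H; change m with (0 + m).
  apply entails_app; [now apply entails_refl|assumption].
Qed.

End Rules.

(** * The hierarchy of predicates *)

(** In [P] the argument [y] moves below a quantifier. It may itself be a bound variable, since [P]
    is applied to [Bound 0], so its indices must be shifted. *)
Fixpoint lift (t : term) : term :=
  match t with
  | Bound i => Bound (S i)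
  | App s t => lift s ∘ lift t
  | Free _ | Const _ => t
  end.

Fixpoint P (k : nat) (y : term) : formula :=
  match k with
  | 0 => All (cp ∘ Bound 0 ≐ cp ∘ (lift y ∘ Bound 0))
  | S k => All (P k (Bound 0) ⊃ P k (lift y ∘ Bound 0))
  end.

Lemma lc_lift j t : lc_term (S j) (lift t) <-> lc_term j t.
Proof. induction t; simpl; [tauto|lia|tauto|tauto]. Qed.

Lemma occurs_lift a t : occurs_term a (lift t) <-> occurs_term a t.
Proof. induction t; simpl; tauto. Qed.

Lemma lc_P k : forall j y, lc_formula j (P k y) <-> lc_term j y.
Proof.
  induction k as [|k IH]; intros j y; simpl.
  - rewrite lc_lift; intuition lia.
  - rewrite !IH; simpl; rewrite lc_lift; intuition lia.
Qed.

Lemma occurs_P a k : forall y, occurs a (P k y) <-> occurs_term a y.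
Proof.
  induction k as [|k IH]; intro y; simpl.
  - rewrite occurs_lift; tauto.
  - rewrite !IH; simpl; rewrite occurs_lift; tauto.
Qed.

Lemma subst_lc u t k : lc_term k t -> subst_term k u t = t.
Proof.
  induction t; simpl; intro H; try reflexivity.
  - destruct (Nat.eqb_spec i k); [lia|reflexivity].
  - now rewrite IHt1, IHt2.
Qed.

Lemma lc_term_le k k' t : k <= k' -> lc_term k t -> lc_term k' t.
Proof. induction t; simpl; [tauto|lia|tauto|tauto]. Qed.

Lemma lift_lc t : lc_term 0 t -> lift t = t.
Proof.
  induction t; simpl; intro H; try reflexivity; [lia|].
  now rewrite IHt1, IHt2.
Qed.

(** The substituted term has no loose index, so it is the same on either side of the extra
    quantifier. *)
Lemma subst_lift j u t :
  lc_term 0 u -> subst_term (S j) u (lift t) = lift (subst_term j u t).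
Proof.
  intro Hu; induction t; simpl; try reflexivity.
  - destruct (Nat.eqb i j); [now rewrite lift_lc|reflexivity].
  - now rewrite IHt1, IHt2.
Qed.

Lemma subst_P u k : lc_term 0 u ->
  forall j y, subst j u (P k y) = P k (subst_term j u y).
Proof.
  intro Hu; induction k as [|k IH]; intros j y; simpl.
  - now rewrite subst_lift.
  - rewrite !IH; simpl; now rewrite subst_lift.
Qed.

Lemma P0_elim G m y t :
  lc_term 0 t -> (G ⊢[m] P 0 y) -> (G ⊢[S m] cp ∘ t ≐ cp ∘ (y ∘ t)).
Proof.
  intros Ht H; pose proof (entails_lc _ _ _ H) as Hy; apply lc_P in Hy.
  apply entails_all_elim with (t := t) in H; [|assumption|];
    unfold inst in *; simpl in *;
    rewrite (lift_lc y), subst_lc in * by assumption; tauto.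
Qed.

(** One critical formula suffices at every level, because [P k w] is detached as a whole and never
    unfolded. *)
Lemma PS_elim G k m m' y w :
  (G ⊢[m] P (S k) y) -> (G ⊢[m'] P k w) -> (G ⊢[S m + m'] P k (y ∘ w)).
Proof.
  intros H Hw; apply entails_mp with (P k w); [|assumption].
  pose proof (entails_lc _ _ _ H) as Hy; apply lc_P in Hy.
  pose proof (entails_lc _ _ _ Hw) as Hlw; apply lc_P in Hlw.
  apply entails_all_elim with (t := w) in H; [|assumption|];
    unfold inst in *; simpl in *;
    rewrite !subst_P in * by assumption; simpl in *;
    rewrite (lift_lc y), subst_lc in * by assumption; [assumption|].
  rewrite !lc_P; simpl; tauto.
Qed.

Lemma P0_intro G m y a :
  lc_term 0 y -> ~ occurs_term a y -> ~ Exists (occurs a) G ->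
  (G ⊢[m] cp ∘ Free a ≐ cp ∘ (y ∘ Free a)) -> (G ⊢[m] P 0 y).
Proof.
  intros Hy Ha HGa H; apply entails_all_intro with a; [| |assumption|];
    rewrite (lift_lc y) by assumption.
  - simpl; intuition auto; apply lc_term_le with 0; auto.
  - simpl; tauto.
  - unfold inst; simpl; now rewrite subst_lc.
Qed.

Lemma PS_intro G k m y a :
  lc_term 0 y -> ~ occurs_term a y -> ~ Exists (occurs a) G ->
  (P k (Free a) :: G ⊢[m] P k (y ∘ Free a)) -> (G ⊢[m] P (S k) y).
Proof.
  intros Hy Ha HGa H; apply entails_all_intro with a; [| |assumption|];
    rewrite (lift_lc y) by assumption.
  - simpl; rewrite !lc_P; simpl; intuition auto; apply lc_term_le with 0; auto.
  - simpl; rewrite !occurs_P; simpl; tauto.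
  - unfold inst; simpl; rewrite !subst_P by exact I; simpl.
    rewrite subst_lc by assumption; now apply entails_intro.
Qed.

(** The equality axioms give replacement in equations only; for the compound formula [P k] it must
    be derived. As a single closed formula it can serve as a shared hypothesis. *)
Definition leibniz (k : nat) : formula :=
  All (All (Bound 1 ≐ Bound 0 ⊃ P k (Bound 1) ⊃ P k (Bound 0))).

Definition doubling : formula :=
  All (All (T ∘ Bound 1 ∘ Bound 0 ≐ Bound 1 ∘ (Bound 1 ∘ Bound 0))).

Lemma lc_leibniz k : lc_formula 0 (leibniz k).
Proof. simpl; rewrite !lc_P; simpl; lia. Qed.

Lemma lc_doubling : lc_formula 0 doubling.
Proof. simpl; intuition lia. Qed.

Lemma occurs_leibniz a k : ~ occurs a (leibniz k).
Proof. simpl; rewrite !occurs_P; simpl; tauto. Qed.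

Lemma occurs_doubling a : ~ occurs a doubling.
Proof. simpl; tauto. Qed.

Lemma leibniz_elim G k m m1 m2 s t :
  (G ⊢[m] leibniz k) -> (G ⊢[m1] s ≐ t) -> (G ⊢[m2] P k s) ->
  (G ⊢[S (S m) + m1 + m2] P k t).
Proof.
  intros H He HP; pose proof (entails_lc _ _ _ He) as [Hs Ht].
  apply entails_mp with (P k s); [|assumption].
  apply entails_mp with (s ≐ t); [|assumption].
  (* Once the outer quantifier is instantiated, [s] stands below the inner one, so well-formedness
     is required at depth 1. *)
  assert (Hs1 : lc_term 1 s) by (apply lc_term_le with 0; auto).
  apply entails_all_elim with (t := s) in H; [|assumption|];
    unfold inst in *; simpl in *; rewrite !subst_P in * by assumption;
    simpl in *.
  - apply entails_all_elim with (t := t) in H; [|assumption|];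
    unfold inst in *; simpl in *; rewrite !subst_P in * by assumption;
    simpl in *; rewrite (subst_lc t s) in * by assumption; [assumption|].
    rewrite !lc_P; tauto.
  - rewrite !lc_P; simpl; intuition lia.
Qed.

Lemma leibniz_intro G k m a b :
  a <> b -> ~ Exists (occurs a) G -> ~ Exists (occurs b) G ->
  (P k (Free a) :: (Free a ≐ Free b) :: G ⊢[m] P k (Free b)) ->
  (G ⊢[m] leibniz k).
Proof.
  intros Hab HGa HGb H; apply entails_all_intro with a;
    [apply lc_leibniz|apply occurs_leibniz|assumption|].
  unfold inst; simpl; rewrite !subst_P by exact I; simpl.
  apply entails_all_intro with b; [| |assumption|].
  - simpl; rewrite !lc_P; simpl; lia.
  - simpl; rewrite !occurs_P; simpl; intuition congruence.
  - unfold inst; simpl; rewrite !subst_P by exact I; simpl.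
    now do 2 apply entails_intro.
Qed.

Lemma doubling_elim G m s t :
  lc_term 0 s -> lc_term 0 t -> (G ⊢[m] doubling) ->
  (G ⊢[S (S m)] T ∘ s ∘ t ≐ s ∘ (s ∘ t)).
Proof.
  intros Hs Ht H.
  assert (Hs1 : lc_term 1 s) by (apply lc_term_le with 0; auto).
  apply entails_all_elim with (t := s) in H; [|assumption|].
  - unfold inst in H; simpl in H.
    apply entails_all_elim with (t := t) in H; [|assumption|];
    unfold inst in *; simpl in *; rewrite (subst_lc t s) in * by assumption;
    [assumption|tauto].
  - simpl; intuition lia.
Qed.

(** * Derivations of constant cost *)

Ltac lc := simpl; repeat split; lia.

Ltac ctx := repeat apply Forall_cons; try apply Forall_nil;
  first [apply lc_leibniz | apply lc_doubling | apply lc_P; lc | lc].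

Ltac not_free := let H := fresh "H" in intro H;
  repeat (apply Exists_cons in H as [H|H];
          [first [apply occurs_leibniz in H | apply occurs_doubling in H
                 | apply occurs_P in H; simpl in H | simpl in H];
           repeat destruct H as [H|H]; first [contradiction | discriminate]|]);
  now apply Exists_nil in H.

Ltac hyp := apply entails_hyp; [ctx|simpl; tauto].

(** The chain is T f x = B f (C B I f) x = f (C B I f x) = f (B f I x) = f (f (I x)) = f (f x). It
    uses four laws with three quantifiers each and the law of I with one, hence 13. *)
Lemma all_lambdaI_doubling : all_lambdaI ⊢[13] doubling.
Proof.
  set (f := Free 0); set (x := Free 1).
  assert (HG : Forall (lc_formula 0) all_lambdaI) by ctx.
  assert (HS : all_lambdaI ⊢[3] T ∘ f ≐ cB ∘ f ∘ (cC ∘ cB ∘ cI ∘ f)).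
  { assert (H : all_lambdaI ⊢[0] nth 0 all_lambdaI top) by hyp.
    apply entails_all_elim with (t := cB) in H; [|lc..].
    apply entails_all_elim with (t := cC ∘ cB ∘ cI) in H; [|lc..].
    apply entails_all_elim with (t := f) in H; [exact H|lc..]. }
  assert (HB1 : all_lambdaI ⊢[3]
    cB ∘ f ∘ (cC ∘ cB ∘ cI ∘ f) ∘ x ≐ f ∘ (cC ∘ cB ∘ cI ∘ f ∘ x)).
  { assert (H : all_lambdaI ⊢[0] nth 1 all_lambdaI top) by hyp.
    apply entails_all_elim with (t := f) in H; [|lc..].
    apply entails_all_elim with (t := cC ∘ cB ∘ cI ∘ f) in H; [|lc..].
    apply entails_all_elim with (t := x) in H; [exact H|lc..]. }
  assert (HC : all_lambdaI ⊢[3] cC ∘ cB ∘ cI ∘ f ≐ cB ∘ f ∘ cI).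
  { assert (H : all_lambdaI ⊢[0] nth 2 all_lambdaI top) by hyp.
    apply entails_all_elim with (t := cB) in H; [|lc..].
    apply entails_all_elim with (t := cI) in H; [|lc..].
    apply entails_all_elim with (t := f) in H; [exact H|lc..]. }
  assert (HB2 : all_lambdaI ⊢[3] cB ∘ f ∘ cI ∘ x ≐ f ∘ (cI ∘ x)).
  { assert (H : all_lambdaI ⊢[0] nth 1 all_lambdaI top) by hyp.
    apply entails_all_elim with (t := f) in H; [|lc..].
    apply entails_all_elim with (t := cI) in H; [|lc..].
    apply entails_all_elim with (t := x) in H; [exact H|lc..]. }
  assert (HI : all_lambdaI ⊢[1] cI ∘ x ≐ x).
  { assert (H : all_lambdaI ⊢[0] nth 3 all_lambdaI top) by hyp.
    apply entails_all_elim with (t := x) in H; [exact H|lc..]. }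
  apply entails_all_intro with 0;
    [lc|apply occurs_doubling|not_free|].
  apply entails_all_intro with 1;
    [lc|simpl; lia|not_free|].
  change (all_lambdaI ⊢[6 + (6 + 1)] T ∘ f ∘ x ≐ f ∘ (f ∘ x)).
  apply entails_trans with (f ∘ (cC ∘ cB ∘ cI ∘ f ∘ x)); [assumption| |].
  - apply (entails_trans _ HG 3 3) with (cB ∘ f ∘ (cC ∘ cB ∘ cI ∘ f) ∘ x);
      [apply entails_app_l; [assumption|exact I|assumption]|assumption].
  - apply entails_app_r; [assumption|exact I|].
    apply entails_trans with (f ∘ (cI ∘ x)); [assumption| |].
    + apply (entails_trans _ HG 3 3) with (cB ∘ f ∘ cI ∘ x);
        [apply entails_app_l; [assumption|exact I|assumption]|assumption].
    + now apply entails_app_r.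
Qed.

(** From a = b and [P 0 a]: p x = p (a x) = p (b x). Only the first equation needs an instance. *)
Lemma leibniz_0 : [] ⊢[1] leibniz 0.
Proof.
  apply leibniz_intro with 0 1; [lia|not_free..|].
  apply P0_intro with 2; [exact I|simpl; lia|not_free|].
  apply entails_trans with (m1 := 1) (m2 := 0)
    (t := (cp ∘ (Free 0 ∘ Free 2))); [ctx| |].
  - apply P0_elim; [exact I|hyp].
  - apply entails_app_r; [ctx|exact I|].
    apply entails_app_l; [ctx|exact I|hyp].
Qed.

(** Given a = b, [P (S k) a] and [P k w], one instance yields P k (a w); since a w = b w, two
    instances for [leibniz k] turn this into P k (b w). *)
Lemma leibniz_S k : [leibniz k] ⊢[3] leibniz (S k).
Proof.
  apply leibniz_intro with 0 1; [lia|not_free..|].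
  apply PS_intro with 2; [exact I|simpl; lia|not_free|].
  apply (leibniz_elim _ _ 0 0 1) with (Free 0 ∘ Free 2).
  - hyp.
  - apply entails_app_l; [ctx|exact I|hyp].
  - apply (PS_elim _ _ 0 0); hyp.
Qed.

(** For y with [P 0 y]: p x = p (y x) = p (y (y x)) = p (T y x). At this level congruence of
    application replaces [leibniz]. *)
Lemma P_1_T : [doubling] ⊢[4] P 1 T.
Proof.
  apply PS_intro with 0; [simpl; tauto|simpl; tauto|not_free|].
  apply P0_intro with 1; [simpl; tauto|simpl; lia|not_free|].
  apply entails_trans with (m1 := 1) (m2 := 3)
    (t := (cp ∘ (Free 0 ∘ Free 1))); [ctx| |].
  { apply P0_elim; [exact I|hyp]. }
  apply entails_trans with (m1 := 1) (m2 := 2)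
    (t := (cp ∘ (Free 0 ∘ (Free 0 ∘ Free 1)))); [ctx| |].
  { apply P0_elim; [simpl; tauto|hyp]. }
  apply entails_app_r; [ctx|exact I|].
  apply entails_sym; [ctx|].
  apply doubling_elim; [exact I|exact I|hyp].
Qed.

(** Two uses of [P (S k) y] lead from w to y (y w), which is then replaced by T y w. The cost is 2
    for these uses, 2 for [doubling] and 2 for [leibniz k]. *)
Lemma P_SS_T k : [leibniz k; doubling] ⊢[6] P (S (S k)) T.
Proof.
  apply PS_intro with 0; [simpl; tauto|simpl; tauto|not_free|].
  apply PS_intro with 1; [simpl; tauto|simpl; lia|not_free|].
  apply (leibniz_elim _ _ 0 2 2) with (Free 0 ∘ (Free 0 ∘ Free 1)).
  - hyp.
  - apply entails_sym; [ctx|].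
    apply doubling_elim; [exact I|exact I|hyp].
  - apply (PS_elim _ _ 0 1); [hyp|].
    apply (PS_elim _ _ 0 0); hyp.
Qed.

(** * Sharing the lemmas *)

(** The order is that of dependence: every entry follows at constant cost from entries further down,
    and [doubling] from the combinator axioms. *)
Fixpoint lemmas (k : nat) : list formula :=
  match k with
  | 0 => [P 1 T; leibniz 0; doubling]
  | S k => P (S (S k)) T :: leibniz (S k) :: lemmas k
  end.

Lemma lemmas_lc k : Forall (lc_formula 0) (lemmas k).
Proof.
  induction k as [|k IH]; cbn [lemmas]; [ctx|].
  constructor; [apply lc_P; simpl; tauto|].
  constructor; [apply lc_leibniz|assumption].
Qed.

Lemma doubling_in_lemmas k : In doubling (lemmas k).
Proof. induction k; cbn [lemmas In]; tauto. Qed.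

Lemma leibniz_in_lemmas k : In (leibniz k) (lemmas k).
Proof. destruct k; cbn [lemmas In]; tauto. Qed.

Lemma P_T_in_lemmas j k : j <= k -> In (P (S j) T) (lemmas k).
Proof.
  induction k as [|k IH]; intro Hj.
  - replace j with 0 by lia; now left.
  - destruct (Nat.eq_dec j (S k)) as [->|Hne]; [now left|].
    right; right; apply IH; lia.
Qed.

Lemma entails_discharge_lemmas G k m A :
  Forall (lc_formula 0) G -> incl all_lambdaI G ->
  (lemmas k ++ G ⊢[m] A) -> (G ⊢[9 * k + 18 + m] A).
Proof.
  intros HG Hi; revert m; induction k as [|k IH]; intros m H.
  (* The summands pay for [doubling], [leibniz 0] and [P 1 T]. *)
  - change (G ⊢[13 + (1 + (4 + m))] A).
    apply entails_cut with all_lambdaI doubling;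
      [assumption..|apply all_lambdaI_doubling|].
    assert (HG1 : Forall (lc_formula 0) (doubling :: G))
      by (constructor; [apply lc_doubling|assumption]).
    apply entails_cut with [] (leibniz 0);
      [assumption|now intros ?|apply leibniz_0|].
    apply entails_cut with [doubling] (P 1 T);
      [constructor; [apply lc_leibniz|assumption]| |apply P_1_T|exact H].
    intros ? [<-|[]]; simpl; tauto.
  - assert (HG1 : Forall (lc_formula 0) (lemmas k ++ G))
      by (apply Forall_app; split; [apply lemmas_lc|assumption]).
    (* The top level costs 3 for [leibniz (S k)] and 6 for [P (S (S k)) T]. These are added to [m],
       which is why the induction generalizes over it. *)
    apply entails_le with (9 * k + 18 + (3 + (6 + m))); [lia|].
    apply IH.
    apply entails_cut with [leibniz k] (leibniz (S k));
      [assumption| |apply leibniz_S|].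
    { intros ? [<-|[]]; apply in_or_app; left; apply leibniz_in_lemmas. }
    apply entails_cut with [leibniz k; doubling] (P (S (S k)) T);
      [constructor; [apply lc_leibniz|assumption]| |apply P_SS_T|exact H].
    intros ? [<-|[<-|[]]]; right; apply in_or_app; left;
      [apply leibniz_in_lemmas|apply doubling_in_lemmas].
Qed.

(** Each further factor T trades one level of the hierarchy for one instance: the formula for [i] at
    level [S (S j)], applied to [P (S j) T], gives the one for [S i] at level [S j]. Hence [j]
    varies in the induction. *)
Lemma entails_P_Tn G k i j :
  Forall (lc_formula 0) G -> incl (lemmas k) G -> i + j = k ->
  (G ⊢[i] P (S j) (Tn (S i))).
Proof.
  intros HG Hi; revert j; induction i as [|i IH]; intros j Hij.
  - apply entails_hyp; [assumption|]; apply Hi, P_T_in_lemmas; lia.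
  - apply entails_le with (S i + 0); [lia|].
    apply PS_elim; [apply IH; lia|].
    apply entails_hyp; [assumption|]; apply Hi, P_T_in_lemmas; lia.
Qed.

Theorem mainTheorem5 :
  exists c d : nat, forall n : nat, 1 <= n ->
    exists pi : proof,
      proves pi (imp_list all_lambdaI (Imp p_invariant (E n))) /\
      cc pi <= c * n + d.
Proof.
  (* With n = k + 1, the shared lemmas cost 9k + 18, reaching [P 1 (Tn n)] costs k, and two more
     instances follow, in all 10k + 20. *)
  exists 10, 20; intros [|k] Hn; [lia|].
  (* Hypotheses are discharged from the head, so the reversed list gives the implications in the
     order of [imp_list]. *)
  set (G := p_invariant :: rev all_lambdaI).
  assert (HG : Forall (lc_formula 0) G) by (unfold G; simpl rev; ctx).
  assert (H : G ⊢[9 * k + 18 + (2 + k)] E (S k)).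
  { apply entails_discharge_lemmas; [assumption| |].
    { intros A HA; right; now apply in_rev in HA. }
    assert (HG1 : Forall (lc_formula 0) (lemmas k ++ G))
      by (apply Forall_app; split; [apply lemmas_lc|assumption]).
    apply P0_elim; [exact I|].
    apply entails_le with (S k + 0); [lia|].
    apply PS_elim.
    - apply entails_P_Tn with k; [assumption| |lia].
      apply incl_appl, incl_refl.
    (* [P 0 cq] is [p_invariant] by computation. *)
    - apply entails_hyp; [assumption|].
      apply in_or_app; right; now left. }
  do 5 apply entails_intro in H.
  (* The empty list of hypotheses leaves the antecedent [top], which is detached. *)
  assert (Htop : thm 0 top) by (apply thm_taut; [simpl; tauto|taut]).
  destruct (thm_mp _ _ _ _ H Htop) as (pi & Hp & Hc).
  exists pi; split; [exact Hp|lia].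
Qed.
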